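(* Let $R$ be a nonzero associative unital ring, let $n$ be a positive integer, let $G$ be a group with identity element $e$, let $\rho$ be a preorder on $\overline{n}=\{1,\ldots,n\}$, let $(\rho_g)_{g\in G}$ be a $G$-grading on $\rho$, and equip the structural matrix ring $M_n(\rho,R)$ with the induced very good $G$-grading $M_n(\rho,R)_g=\sum_{(i,j)\in\rho_g}Re_{i,j}$ ($g\in G$). The following assertions hold: (i) the $G$-grading on $\rho$ is trivial if and only if the induced $G$-grading on $M_n(\rho,R)$ is trivial; (ii) the $G$-grading on $\rho$ is symmetric if and only if the induced $G$-grading on $M_n(\rho,R)$ is symmetric; (iii) the $G$-grading on $\rho$ is epsilon-strong if and only if the induced $G$-grading on $M_n(\rho,R)$ is epsilon-strong; (iv) the $G$-grading on $\rho$ is strong if and only if the induced $G$-grading on $M_n(\rho,R)$ is strong; (v) if the $G$-grading on $\rho$ is an epsilon-crossed product, then the induced $G$-grading on $M_n(\rho,R)$ is an epsilon-crossed product; (vi) if the $G$-grading on $\rho$ is a crossed product, then the induced $G$-grading on $M_n(\rho,R)$ is a crossed product.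
   Context: Relations. Put $\overline{n}=\{1,\ldots,n\}$, $\overline{n}^{\,2}=\overline{n}\times\overline{n}$ and $\Delta=\{(i,i)\mid i\in\overline{n}\}$. For $X,Y\subseteq\overline{n}^{\,2}$ put $XY=\{(i,k)\mid \exists j\in\overline{n}:\ (i,j)\in X,\ (j,k)\in Y\}$. In such products a pair $(i,j)$ is identified with the singleton $\{(i,j)\}$. A preorder is a reflexive and transitive relation $\rho\subseteq\overline{n}^{\,2}$. A $G$-grading on $\rho$ is a family $(\rho_g)_{g\in G}$ of pairwise disjoint (possibly empty) subsets of $\rho$ with $\rho=\bigcup_{g\in G}\rho_g$ and $\rho_g\rho_h\subseteq\rho_{gh}$ for all $g,h\in G$. It is called: - trivial if $\rho_g=\emptyset$ for all $g\in G\setminus\{e\}$; - symmetric if $\rho_g\rho_{g^{-1}}\rho_g=\rho_g$ for all $g\in G$; - strong if $\rho_g\rho_{g^{-1}}=\rho_e$ for all $g\in G$; - a crossed product if for each $g\in G$ there are $U_g\subseteq\rho_g$ and $V_{g^{-1}}\subseteq\rho_{g^{-1}}$ with $U_gV_{g^{-1}}=V_{g^{-1}}U_g=\Delta$; - epsilon-strong if for each $g\in G$ there is a subset $E_g\subseteq(\rho_g\rho_{g^{-1}})\cap\Delta$ such that $(i,j)=E_g(i,j)=(i,j)E_{g^{-1}}$ for every $g\in G$ and $(i,j)\in\rho_g$; - an epsilon-crossed product if it is epsilon-strong (with sets $E_g$ as in the previous item) and for each $g\in G$ there are $U_g\subseteq\rho_g$ and $V_{g^{-1}}\subseteq\rho_{g^{-1}}$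 with $U_gV_{g^{-1}}=E_g$ and $V_{g^{-1}}U_g=E_{g^{-1}}$. Rings. $e_{i,j}$ is the $n\times n$ matrix over $R$ with $1$ in position $(i,j)$ and zeros elsewhere, and $M_n(\rho,R)=\sum_{(i,j)\in\rho}Re_{i,j}\subseteq M_n(R)$ with matrix multiplication. A $G$-grading on a unital ring $S$ is a family $(S_g)_{g\in G}$ of additive subgroups with $S=\bigoplus_{g\in G}S_g$ and $S_gS_h\subseteq S_{gh}$, where a product of additive subgroups denotes the additive subgroup generated by products of elements. It is called: - trivial if $S_g=\{0\}$ for all $g\ne e$; - symmetric if $S_gS_{g^{-1}}S_g=S_g$ for all $g$; - strong if $S_gS_{g^{-1}}=S_e$ for all $g$; - a crossed product if every $S_g$ contains an element invertible in $S$; - epsilon-strong if for every $g\in G$ there is $\epsilon_g\in S_gS_{g^{-1}}$ such that $\epsilon_gs=s\epsilon_{g^{-1}}=s$ for all $g\in G$, $s\in S_g$; - an epsilon-crossed product if it is epsilon-strong and for every $g\in G$ there are $s_g\in S_g$ and $t_{g^{-1}}\in S_{g^{-1}}$ with $s_gt_{g^{-1}}=\epsilon_g$ and $t_{g^{-1}}s_g=\epsilon_{g^{-1}}$. A $G$-grading on $M_n(\rho,R)$ is called very good if it is of the form $M_n(\rho,R)_g=\sum_{(i,j)\in\rho_g}Re_{i,j}$ for some $G$-grading $(\rho_g)_{g\in G}$ on $\rho$. *)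

(* Defs.v *)
From HB Require Import structures.
From mathcomp Require Import all_boot all_algebra.
From mathcomp Require Import all_classical.

Set Implicit Arguments.
Unset Strict Implicit.
Unset Printing Implicit Defensive.

Import GRing.Theory.

Local Open Scope classical_set_scope.
Local Open Scope ring_scope.

(* The index set {1, ..., n} is rendered as 'I_n. *)
Notation binrel n := (set ('I_n * 'I_n)).

(* The library's [Y \; X] composes right to left, hence the swap: [relmul X Y] is
   XY = {(i, k) | exists j, (i, j) in X and (j, k) in Y}. *)
Definition relmul (n : nat) (X Y : binrel n) : binrel n := (Y \; X)%relation.

Record preord (n : nat) : Type := Preord {
  prel :> binrel n;
  prel_refl : forall i, prel (i, i);
  prel_trans : forall i j k, prel (i, j) -> prel (j, k) -> prel (i, k)
}.

Record relGrading (G : groupType) (n : nat) (rho : preord n) : Type :=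
  RelGrading {
    rcomp :> G -> binrel n;
    rcomp_disj : trivIset setT rcomp;
    rcomp_cover : prel rho = \bigcup_g rcomp g;
    rcomp_mul : forall g h : G,
      relmul (rcomp g) (rcomp h) `<=` rcomp (g * h)%g
  }.

Section RelationGradings.
Context (G : groupType) (n : nat) (rho : preord n) (rho_ : relGrading G rho).

Definition rel_trivial : Prop := forall g : G, g <> 1%g -> rho_ g = set0.

Definition rel_symmetric : Prop :=
  forall g : G, relmul (relmul (rho_ g) (rho_ g^-1%g)) (rho_ g) = rho_ g.

Definition rel_strong : Prop :=
  forall g : G, relmul (rho_ g) (rho_ g^-1%g) = rho_ 1%g.

Definition rel_crossed : Prop :=
  forall g : G, exists U V : binrel n,
    [/\ U `<=` rho_ g, V `<=` rho_ g^-1%g,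
        relmul U V = diagonal & relmul V U = diagonal].

Definition rel_epsilon_family (E : G -> binrel n) : Prop :=
  (forall g : G, E g `<=` relmul (rho_ g) (rho_ g^-1%g) `&` diagonal) /\
  (forall (g : G) (i j : 'I_n), rho_ g (i, j) ->
     relmul (E g) [set (i, j)] = [set (i, j)] /\
     relmul [set (i, j)] (E g^-1%g) = [set (i, j)]).

Definition rel_epsilon_strong : Prop :=
  exists E : G -> binrel n, rel_epsilon_family E.

Definition rel_epsilon_crossed : Prop :=
  exists2 E : G -> binrel n, rel_epsilon_family E &
    forall g : G, exists U V : binrel n,
      [/\ U `<=` rho_ g, V `<=` rho_ g^-1%g,
          relmul U V = E g & relmul V U = E g^-1%g].

End RelationGradings.

Definition is_addsubgroup (V : zmodType) (A : set V) : Prop :=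
  A 0 /\ (forall x y, A x -> A y -> A (x - y)).

(* The additive subgroup generated by the products xy, x in A, y in B. *)
Definition addmul (S : pzRingType) (A B : set S) : set S :=
  smallest (@is_addsubgroup S) [set x * y | x in A & y in B].

(* [gcomp_direct] is S = (+)_g S_g: every s is, in exactly one way, the sum of a
   finitely supported family of elements of the S_g. The finiteness clause is
   needed because [\sum_(g \in _)] is 0 on infinite supports. *)
Record ringGrading (G : groupType) (S : pzRingType) : Type := RingGrading {
  gcomp :> G -> set S;
  gcomp_subgroup : forall g, is_addsubgroup (gcomp g);
  gcomp_direct : forall s : S, exists! f : G -> S,
    [/\ forall g, gcomp g (f g), finite_set [set g | f g <> 0]
      & s = \sum_(g \in setT) f g];
  gcomp_mul : forall g h : G,
    addmul (gcomp g) (gcomp h) `<=` gcomp (g * h)%g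
}.

Section RingGradings.
Context (G : groupType) (S : pzRingType) (S_ : ringGrading G S).

Definition ring_trivial : Prop := forall g : G, g <> 1%g -> S_ g = [set 0].

Definition ring_symmetric : Prop :=
  forall g : G, addmul (addmul (S_ g) (S_ g^-1%g)) (S_ g) = S_ g.

Definition ring_strong : Prop :=
  forall g : G, addmul (S_ g) (S_ g^-1%g) = S_ 1%g.

Definition ring_crossed : Prop :=
  forall g : G, exists2 s : S, S_ g s & exists t : S, s * t = 1 /\ t * s = 1.

Definition ring_epsilon_family (eps : G -> S) : Prop :=
  (forall g : G, addmul (S_ g) (S_ g^-1%g) (eps g)) /\
  (forall (g : G) (s : S), S_ g s -> eps g * s = s /\ s * eps g^-1%g = s).

Definition ring_epsilon_strong : Prop :=
  exists eps : G -> S, ring_epsilon_family eps.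

Definition ring_epsilon_crossed : Prop :=
  exists2 eps : G -> S, ring_epsilon_family eps &
    forall g : G, exists s t : S,
      [/\ S_ g s, S_ g^-1%g t, s * t = eps g & t * s = eps g^-1%g].

End RingGradings.

(* The sum over (i, j) in X of the R e_{i,j}, inside the full matrix ring. *)
Definition mxspan (R : pzRingType) (n : nat) (X : binrel n) : set 'M[R]_n :=
  [set A | exists c : 'I_n * 'I_n -> R,
     A = \sum_(p : 'I_n * 'I_n | p \in X) c p *: delta_mx p.1 p.2].
Arguments mxspan R {n} X _.

Section MxSpan.
Context (R : pzRingType) (n : nat).
Implicit Types (X Y : binrel n) (A B : 'M[R]_n).

Lemma sum_deltaE X (c : 'I_n * 'I_n -> R) i j :
  (\sum_(p : 'I_n * 'I_n | p \in X) c p *: delta_mx p.1 p.2 : 'M[R]_n) i j =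
  if (i, j) \in X then c (i, j) else 0.
Proof.
rewrite summxE; case: ifPn => ijX.
  rewrite (bigD1 (i, j)) //= !mxE !eqxx mulr1 big1 ?addr0// => -[k l] /=.
  move=> /andP[_]; rewrite !mxE xpair_eqE (eq_sym i) (eq_sym j) => /negbTE ->.
  by rewrite mulr0.
rewrite big1// => -[k l] /= klX; rewrite !mxE.
case: (eqVneq i k) => [ik|]; last by rewrite mulr0.
case: (eqVneq j l) => [jl|]; last by rewrite mulr0.
by move: ijX; rewrite ik jl klX.
Qed.

Lemma mxspanP X A :
  mxspan R X A <-> (forall i j, ~ X (i, j) -> A i j = 0).
Proof.
split=> [[c ->] i j nX|A0].
  by rewrite sum_deltaE memNset.
exists (fun p => A p.1 p.2); apply/matrixP => i j; rewrite sum_deltaE.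
by case: ifPn => //; rewrite notin_setE => /A0.
Qed.

Lemma mxspan_subgroup X : is_addsubgroup (mxspan R X).
Proof.
split=> [|A B /mxspanP A0 /mxspanP B0]; apply/mxspanP => i j nX.
  by rewrite mxE.
by rewrite !mxE A0// B0// subr0.
Qed.

Lemma mxspan_mul X Y A B :
  mxspan R X A -> mxspan R Y B -> mxspan R (relmul X Y) (A *m B).
Proof.
move=> /mxspanP A0 /mxspanP B0; apply/mxspanP => i j nXY.
rewrite mxE big1// => k _.
have [ikX|nik] := pselect (X (i, k)); last by rewrite A0// mul0r.
have [kjY|nkj] := pselect (Y (k, j)); last by rewrite B0// mulr0.
by case: nXY; exists k.
Qed.

Lemma mxspan_sub X Y : X `<=` Y -> mxspan R X `<=` mxspan R Y.
Proof.
by move=> XY A /mxspanP A0; apply/mxspanP => i j nY; apply: A0 => /XY.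
Qed.

End MxSpan.

Section StructuralMatrixRing.
Context (R : pzRingType) (n : nat) (rho : preord n).

Definition smx_pred : {pred 'M[R]_n} := fun A => A \in mxspan R rho.

Lemma smx_subring_closed : subring_closed smx_pred.
Proof.
split=> [|A B|A B].
- rewrite inE; apply/mxspanP => i j nrho; rewrite mxE.
  by case: eqP => // ij; case: nrho; rewrite ij; apply: prel_refl.
- rewrite !inE; exact: (mxspan_subgroup R rho).2.
rewrite !inE => Ar Br; apply: mxspan_sub (mxspan_mul Ar Br).
by move=> [i k] [j /= ij jk]; apply: prel_trans ij jk.
Qed.

(* M_n(rho, R) *)
Record smring : Type := SMRing { smval : 'M[R]_n; smvalP : smx_pred smval }.

HB.instance Definition _ := [isSub for smval].
HB.instance Definition _ := [Choice of smring by <:].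
HB.instance Definition _ :=
  GRing.SubChoice_isSubPzRing.Build 'M[R]_n smx_pred smring smx_subring_closed.

End StructuralMatrixRing.

Section InducedGrading.
Context (R : pzRingType) (G : groupType) (n : nat) (rho : preord n).
Context (rho_ : relGrading G rho).

Definition very_good_comp (g : G) : set (smring R rho) :=
  [set A | mxspan R (rho_ g) (smval A)].

Lemma very_good_subgroup g : is_addsubgroup (very_good_comp g).
Proof.
have [h0 hB] := mxspan_subgroup R (rho_ g).
by split=> [|A B Ag Bg]; [exact: h0|exact: hB].
Qed.

Lemma very_good_mul g h :
  addmul (very_good_comp g) (very_good_comp h) `<=` very_good_comp (g * h)%g.
Proof.
apply: smallest_sub; first exact: very_good_subgroup.
move=> _ [A Ag [B Bh <-]].
exact: mxspan_sub (@rcomp_mul _ _ _ rho_ g h) _ (mxspan_mul Ag Bh).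
Qed.

Let smval_sum (r : seq G) (f : G -> smring R rho) :
  smval (\sum_(g <- r) f g) = \sum_(g <- r) smval (f g).
Proof. exact: (raddf_sum (val : smring R rho -> 'M[R]_n)). Qed.

Let smval_fsum (f : G -> smring R rho) (i j : 'I_n) :
  finite_set [set g | f g <> 0] ->
  smval (\sum_(g \in setT) f g) i j = \sum_(g \in setT) smval (f g) i j.
Proof.
move=> finf; rewrite smval_sum summxE.
rewrite [RHS](fsbigE (finite_support 0 setT f))//.
  by apply: eq_bigl => g; rewrite in_setT.
move=> g _ ng; suff -> : f g = 0 by rewrite mxE.
apply: contrapT => fg; move/negP: ng; apply.
by rewrite in_finite_support ?setTI// inE.
Qed.

Let rcomp_uniq g h p : rho_ g p -> rho_ h p -> g = h.
Proof. by move=> gp hp; apply: (@rcomp_disj _ _ _ rho_) => //; exists p. Qed.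

Let very_good_sumE (f : G -> smring R rho) g i j :
  (forall h, very_good_comp h (f h)) -> finite_set [set h | f h <> 0] ->
  rho_ g (i, j) -> smval (\sum_(h \in setT) f h) i j = smval (f g) i j.
Proof.
move=> fh finf gij; rewrite smval_fsum//.
rewrite -(@fsbig_widen _ _ _ _ [set g] setT) ?fsbig_set1// => h [_ /= hg].
by move/mxspanP: (fh h); apply=> /(rcomp_uniq gij) /esym.
Qed.

Lemma very_good_direct (s : smring R rho) : exists! f : G -> smring R rho,
  [/\ forall g, very_good_comp g (f g), finite_set [set g | f g <> 0]
    & s = \sum_(g \in setT) f g].
Proof.
have out (A : smring R rho) i j : ~ prel rho (i, j) -> smval A i j = 0.
  by move=> nij; have := smvalP A; rewrite /smx_pred inE => /mxspanP; apply.
have deg i j : prel rho (i, j) -> exists g, rho_ g (i, j).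
  by rewrite (rcomp_cover rho_) => -[g _ gij]; exists g.
pose B g := \matrix_(i, j) if (i, j) \in rho_ g then smval s i j else 0.
have Bg g : mxspan R (rho_ g) (B g).
  by apply/mxspanP => i j nij; rewrite mxE memNset.
have Br g : smx_pred rho (B g).
  rewrite /smx_pred inE; apply: mxspan_sub (Bg g) => p gp.
  by rewrite (rcomp_cover rho_); exists g.
pose f g := SMRing (Br g).
have f0 g : rho_ g = set0 -> f g = 0.
  by move=> g0; apply: val_inj; apply/matrixP => i j; rewrite !mxE g0 in_set0.
have finf : finite_set [set g | f g <> 0].
  pose d p : G := xget 1%g [set g | rho_ g p].
  apply: (@sub_finite_set _ _ (d @` setT)); last exact: finite_image.
  move=> g /= fg; have /set0P[p gp] : rho_ g != set0.
    by apply/eqP => /f0.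
  exists p => //; apply/esym/(rcomp_uniq gp).
  exact: (xgetPex 1%g (ex_intro (fun g => rho_ g p) g gp)).
exists f; split=> [|h [hg finh hs]].
  split=> //; apply: val_inj; apply/matrixP => i j.
  have [/deg[g gij]|nij] := pselect (prel rho (i, j)); last by rewrite !out.
  by rewrite [RHS](very_good_sumE _ _ gij)//= mxE mem_set.
apply/funext => g; apply: val_inj; apply/matrixP => i j.
have [gij|nij] := pselect (rho_ g (i, j)).
  by rewrite -[RHS](very_good_sumE _ _ gij)// -hs /= mxE mem_set.
rewrite /= mxE memNset//; apply/esym.
by move/mxspanP: (hg g); apply.
Qed.

Definition very_good_grading : ringGrading G (smring R rho) :=
  RingGrading very_good_subgroup very_good_direct very_good_mul.

End InducedGrading.

(* Main.v *)
(* The map X |-> sum over (i, j) in X of R e_{i,j} is injective on subsets of rho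
   (as 1 <> 0) and turns products of relations into products of additive
   subgroups, because a e_{i,j} = (a e_{i,k}) (1 e_{k,j}). This settles (i), (ii)
   and (iv). For the epsilon and crossed conditions, a set of pairs X is
   represented by its 0-1 indicator matrix; conversely, epsilon_g e_{i,j} =
   e_{i,j} forces the (i, i) entry of epsilon_g to be 1, so that (i, i) lies in
   rho_g rho_{g^-1}. *)
Require Import Defs.
From mathcomp Require Import all_boot all_algebra.
From mathcomp Require Import all_classical.

Set Implicit Arguments.
Unset Strict Implicit.
Unset Printing Implicit Defensive.

Import GRing.Theory.

Local Open Scope classical_set_scope.
Local Open Scope ring_scope.

(** * Additive subgroups generated by products *)

Lemma addmul_subgroup (S : pzRingType) (A B : set S) :
  is_addsubgroup (addmul A B).
Proof.
split=> [C [[C0 _] _] //|x y Ax Ay C [Csub sC]].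
by apply: Csub.2; [exact: Ax|exact: Ay].
Qed.

Lemma addmul_prod (S : pzRingType) (A B : set S) (x y : S) :
  A x -> B y -> addmul A B (x * y).
Proof. by move=> Ax By C [_ sC]; apply: sC; exists x => //; exists y. Qed.

Lemma addsubgroup_sum (V : zmodType) (A : set V) (I : Type) (r : seq I)
    (P : pred I) (F : I -> V) :
  is_addsubgroup A -> (forall i, P i -> A (F i)) -> A (\sum_(i <- r | P i) F i).
Proof.
move=> [A0 AB] AF; apply: (big_ind A) => // x y Ax Ay.
(* Closure under differences yields sums through x + y = x - (0 - y). *)
by rewrite -[y]opprK; apply: (AB) => //; rewrite -[- y]add0r; exact: AB.
Qed.

(** * Indicator matrices of relations *)

Section MxSpanFacts.
Context (R : pzRingType) (n : nat).
Implicit Types (X Y U V : binrel n).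

Lemma mxspan_delta X (i j : 'I_n) (a : R) :
  X (i, j) -> mxspan R X (a *: delta_mx i j).
Proof.
move=> Xij; apply/mxspanP => k l nX; rewrite !mxE.
case: (eqVneq k i) => [ki|_]; last by rewrite mulr0.
case: (eqVneq l j) => [lj|_]; last by rewrite mulr0.
by case: nX; rewrite ki lj.
Qed.

Definition mxind X : 'M[R]_n := \matrix_(i, j) ((i, j) \in X)%:R.

Lemma mxspan_mxind X : mxspan R X (mxind X).
Proof. by apply/mxspanP => i j nX; rewrite mxE memNset. Qed.

Lemma mxind_diagonal : mxind diagonal = 1%:M.
Proof.
apply/matrixP => i j; rewrite !mxE.
case: eqP => [->|ij]; first by rewrite mem_set.
by rewrite memNset.
Qed.

Lemma mxind_mull X (A : 'M[R]_n) i j : X `<=` diagonal ->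
  (mxind X *m A) i j = ((i, i) \in X)%:R * A i j.
Proof.
move=> Xd; rewrite mxE (bigD1 i)//= big1 ?addr0 ?mxE// => k ki.
rewrite mxE memNset ?mul0r// => Xik.
by rewrite [i](Xd _ Xik) eqxx in ki.
Qed.

Lemma mxind_mulr X (A : 'M[R]_n) i j : X `<=` diagonal ->
  (A *m mxind X) i j = A i j * ((j, j) \in X)%:R.
Proof.
move=> Xd; rewrite mxE (bigD1 j)//= big1 ?addr0 ?mxE// => k kj.
rewrite mxE memNset ?mulr0// => Xkj.
by rewrite -[j](Xd _ Xkj) eqxx in kj.
Qed.

(* An entry of the product counts the k with (i, k) in U and (k, j) in V. As UV
   is diagonal, j = i, and then VU being diagonal makes k unique. *)
Lemma mxind_mul U V : relmul U V `<=` diagonal -> relmul V U `<=` diagonal ->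
  mxind U *m mxind V = mxind (relmul U V).
Proof.
move=> UVd VUd; apply/matrixP => i j; rewrite !mxE.
have [[k /= Uik Vkj]|nUV] := pselect (relmul U V (i, j)); last first.
  rewrite [in RHS]memNset// big1// => k _; rewrite !mxE -natrM mulnb.
  by case: andP => // -[/set_mem Uik /set_mem Vkj]; case: nUV; exists k.
have ij : i = j by apply: (UVd (i, j)); exists k.
rewrite [in RHS]mem_set; last by exists k.
rewrite (bigD1 k)//= !mxE !mem_set// mulr1 big1 ?addr0// => l lk.
rewrite !mxE [(l, j) \in V](_ : _ = false) ?mulr0//.
apply: memNset => Vlj; move/eqP: lk; apply.
by apply: (VUd (l, k)); exists j => //=; rewrite -ij.
Qed.

End MxSpanFacts.
Arguments mxind R {n} X.

(** * Products of relations *)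

Lemma relmul_preord (n : nat) (rho : preord n) (X Y : binrel n) :
  X `<=` rho -> Y `<=` rho -> relmul X Y `<=` rho.
Proof. by move=> Xr Yr [i k] [j /= /Xr ij /Yr]; exact: prel_trans. Qed.

Lemma rcomp_sub (G : groupType) (n : nat) (rho : preord n)
  (rho_ : relGrading G rho) (g : G) : rho_ g `<=` rho.
Proof. by move=> p gp; rewrite (rcomp_cover rho_); exists g. Qed.

(** For diagonal X, only (i, i) can compose with (i, j) on the left, so the product is either {(i,
    j)} or empty. *)
Lemma relmul_diag1 (n : nat) (X : binrel n) (i j : 'I_n) : X `<=` diagonal ->
  relmul X [set (i, j)] = [set (i, j)] <-> X (i, i).
Proof.
move=> Xd; split=> [e|Xi].
  by have /= : relmul X [set (i, j)] (i, j) by [rewrite e]; case=> k /= Xk [ki]; rewrite -{2}ki.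
apply/seteqP; split=> [[k l] [m /= Xkm [mi ->]]|_ ->]; last by exists i.
by rewrite -mi [k](Xd _ Xkm).
Qed.

Lemma relmul_diag2 (n : nat) (X : binrel n) (i j : 'I_n) : X `<=` diagonal ->
  relmul [set (i, j)] X = [set (i, j)] <-> X (j, j).
Proof.
move=> Xd; split=> [e|Xj].
  by have /= : relmul [set (i, j)] X (i, j) by [rewrite e]; case=> k /= [kj] Xkj; rewrite -{1}kj.
apply/seteqP; split=> [[k l] [m /= [-> mj] Xml]|_ ->]; last by exists j.
by rewrite -[l](Xd _ Xml) mj.
Qed.

(** * Spans inside the structural matrix ring *)

Section Span.
Context (R : pzRingType) (n : nat) (rho : preord n).
Implicit Types (X Y : binrel n).

(** For X = [rho_ g] this unfolds to the component of degree g. Allowing any X also covers products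
    of components and the empty set. *)
Definition smspan X : set (smring R rho) := [set A | mxspan R X (smval A)].

(* 0 unless A lies in M_n(rho, R). *)
Definition smlift (A : 'M[R]_n) : smring R rho := insubd (0 : smring R rho) A.

Lemma smliftK X (A : 'M[R]_n) :
  X `<=` rho -> mxspan R X A -> smval (smlift A) = A.
Proof.
move=> Xr XA; apply: (insubdK (0 : smring R rho)).
by rewrite unfold_in /smx_pred inE; exact: mxspan_sub XA.
Qed.

Lemma smspan_lift X (A : 'M[R]_n) :
  X `<=` rho -> mxspan R X A -> smspan X (smlift A).
Proof. by move=> Xr XA; rewrite /smspan /= (smliftK Xr). Qed.

Lemma smspan_subgroup X : is_addsubgroup (smspan X).
Proof.
have [h0 hB] := mxspan_subgroup R X.
by split=> [|A B Ag Bg]; [exact: h0|exact: hB].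
Qed.

Lemma smspan0 : smspan set0 = [set 0].
Proof.
apply/seteqP; split=> [A /mxspanP A0|_ ->]; last exact: (smspan_subgroup set0).1.
by apply: val_inj; apply/matrixP => i j; rewrite /= A0// mxE.
Qed.

Lemma addmul_smspan X Y : X `<=` rho -> Y `<=` rho ->
  addmul (smspan X) (smspan Y) = smspan (relmul X Y).
Proof.
move=> Xr Yr; apply/seteqP; split.
  apply: smallest_sub; first exact: smspan_subgroup.
  by move=> _ [A XA [B YB <-]]; exact: mxspan_mul.
move=> A XYA.
(* A is the sum of its entries times matrix units; those at positions outside [relmul X Y] vanish,
   so each remaining summand can be factored separately. *)
have -> : A = \sum_(p : 'I_n * 'I_n | p \in relmul X Y)
    smlift (smval A p.1 p.2 *: delta_mx p.1 p.2).
  apply: val_inj; rewrite raddf_sum /=; apply/matrixP => i j.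
  rewrite (eq_bigr (fun p => smval A p.1 p.2 *: delta_mx p.1 p.2)).
    rewrite (sum_deltaE _ (fun p => smval A p.1 p.2)).
    by case: ifPn => //; rewrite notin_setE; move/mxspanP: XYA => /[apply].
  move=> [k l] /set_mem XYkl; apply: (smliftK (relmul_preord Xr Yr)).
  exact: mxspan_delta.
apply: addsubgroup_sum => [|[i j] /set_mem XYij]; first exact: addmul_subgroup.
have [k /= Xik Ykj] := XYij.
have dX := mxspan_delta (smval A i j) Xik; have dY := mxspan_delta (1 : R) Ykj.
have -> : smlift (smval A i j *: delta_mx i j) =
    smlift (smval A i j *: delta_mx i k) * smlift (1 *: delta_mx k j).
  apply: val_inj; rewrite /= (smliftK (relmul_preord Xr Yr)) ?(smliftK Xr dX)//.
    rewrite (smliftK Yr dY) scale1r.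
    by rewrite [RHS](_ : _ = smval A i j *: delta_mx i k *m delta_mx k j)//
      -scalemxAl mul_delta_mx.
  exact: mxspan_delta.
by apply: addmul_prod; exact: smspan_lift.
Qed.

End Span.
Arguments smspan R {n} rho X.
Arguments smlift {R n} rho A.

Lemma smspan_inj (R : nzRingType) (n : nat) (rho : preord n) (X Y : binrel n) :
  X `<=` rho -> Y `<=` rho -> smspan R rho X = smspan R rho Y -> X = Y.
Proof.
suff sub X' Y' : X' `<=` rho -> smspan R rho X' = smspan R rho Y' -> X' `<=` Y'.
  by move=> Xr Yr XY; apply/seteqP; split; apply: sub.
move=> Xr XY [i j] Xij; apply: contrapT => nY.
(* The matrix unit at (i, j) lies in the span of X', hence of Y', so its entry 1 at (i, j) would
   have to be 0. *)
have := smspan_lift Xr (mxspan_delta (1 : R) Xij).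
rewrite XY => /mxspanP/(_ i j nY).
rewrite (smliftK Xr (mxspan_delta 1 Xij)) !mxE !eqxx mulr1.
exact/eqP/oner_neq0.
Qed.

(** * Transfer of epsilon families *)

Section EpsilonFamilies.
Context (R : pzRingType) (G : groupType) (n : nat) (rho : preord n).
Context (rho_ : relGrading G rho).

Let comp_sub := rcomp_sub (rho_ := rho_).

(** The indicator of a diagonal set is a projection onto rows (or columns). A nonzero entry of s at
    (i, j) forces (i, j) into [rho_ g], and then the unit conditions on E put (i, i) in [E g] and
    (j, j) in [E g^-1], so that entry is kept. *)
Lemma epsilon_family_mxind (E : G -> binrel n) :
  rel_epsilon_family rho_ E ->
  ring_epsilon_family (very_good_grading R rho_)
    (fun g => smlift rho (mxind R (E g))).
Proof.
move=> [Esub Eunit].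
have Ed g : E g `<=` diagonal by move=> p /Esub[].
have Em g : E g `<=` relmul (rho_ g) (rho_ g^-1%g) by move=> p /Esub[].
have Er g : E g `<=` rho.
  by apply: subset_trans (Em g) _; apply: relmul_preord; exact: comp_sub.
have EK g := smliftK (@Er g) (mxspan_mxind R (E g)).
split=> [g|g s /mxspanP sg].
  rewrite -/(smspan R rho (rho_ g)) -/(smspan R rho (rho_ g^-1%g)).
  rewrite addmul_smspan; [|exact: comp_sub..].
  by rewrite /smspan /= EK; apply: mxspan_sub (mxspan_mxind _ _).
have unit i j : rho_ g (i, j) -> E g (i, i) /\ E g^-1%g (j, j).
  by move=> /Eunit[/(relmul_diag1 _ _ (@Ed _)) ? /(relmul_diag2 _ _ (@Ed _))].
split; apply: val_inj; apply/matrixP => i j; rewrite /= EK.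
  rewrite mxind_mull//; have [/unit[Ei _]|/sg->] := pselect (rho_ g (i, j)).
    by rewrite mem_set// mul1r.
  by rewrite mulr0.
rewrite mxind_mulr//; have [/unit[_ Ej]|/sg->] := pselect (rho_ g (i, j)).
  by rewrite mem_set// mulr1.
by rewrite mul0r.
Qed.

End EpsilonFamilies.

Lemma ring_epsilon_strong_rel (R : nzRingType) (G : groupType) (n : nat)
    (rho : preord n) (rho_ : relGrading G rho) :
  ring_epsilon_strong (very_good_grading R rho_) -> rel_epsilon_strong rho_.
Proof.
move=> [eps [epsm epsu]].
(* The largest choice compatible with the inclusion required of an epsilon family; only the unit
   conditions remain. *)
pose E g : binrel n := relmul (rho_ g) (rho_ g^-1%g) `&` diagonal.
exists E; split=> [g|g i j gij]; first exact: subset_refl.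
have Ed h : E h `<=` diagonal by move=> p [].
(* [eps h] is supported on [relmul (rho_ h) (rho_ h^-1)], so its nonzero diagonal entries mark
   elements of [E h]. *)
have epsE h k : smval (eps h) k k <> 0 -> E h (k, k).
  move=> ek; split=> //; apply: contrapT => nk; apply: ek.
  have := epsm h; rewrite -/(smspan R rho (rho_ h)) -/(smspan R rho (rho_ h^-1%g)).
  by rewrite addmul_smspan; [move/mxspanP; apply|exact: rcomp_sub..].
have dg := mxspan_delta (1 : R) gij.
have dK := smliftK (@rcomp_sub _ _ _ rho_ g) dg.
have [|el er] := epsu g (smlift rho (1 *: delta_mx i j)).
  exact: (smspan_lift (@rcomp_sub _ _ _ rho_ g) dg).
have entry : (delta_mx i j : 'M[R]_n) i j = 1 by rewrite mxE !eqxx.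
move: el er => /(congr1 (fun s => smval s i j)) /= el.
move=> /(congr1 (fun s => smval s i j)) /= er.
rewrite dK scale1r entry in el er.
(* If the relevant diagonal entry of epsilon were 0, the (i, j) entry of its product with the matrix
   unit would be 0 instead of 1. *)
split; [apply/relmul_diag1 => //|apply/relmul_diag2 => //]; apply: epsE => e0.
  move: el; rewrite mxE (bigD1 i)//= e0 mul0r add0r big1 => [/esym/eqP|k ki].
    by rewrite oner_eq0.
  by rewrite mxE (negbTE ki) mulr0.
move: er; rewrite mxE (bigD1 j)//= e0 mulr0 add0r big1 => [/esym/eqP|k kj].
  by rewrite oner_eq0.
by rewrite mxE (negbTE kj) andbF mul0r.
Qed.

Theorem theorem20 (R : nzRingType) (n : nat) (n_gt0 : (0 < n)%N)
    (G : groupType) (rho : preord n) (rho_ : relGrading G rho) :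
  (rel_trivial rho_ <-> ring_trivial (very_good_grading R rho_)) /\
  (rel_symmetric rho_ <-> ring_symmetric (very_good_grading R rho_)) /\
  (rel_epsilon_strong rho_ <->
     ring_epsilon_strong (very_good_grading R rho_)) /\
  (rel_strong rho_ <-> ring_strong (very_good_grading R rho_)) /\
  (rel_epsilon_crossed rho_ ->
     ring_epsilon_crossed (very_good_grading R rho_)) /\
  (rel_crossed rho_ -> ring_crossed (very_good_grading R rho_)).
Proof.
have sub g : rho_ g `<=` rho := @rcomp_sub _ _ _ rho_ g.
have sub2 g h : relmul (rho_ g) (rho_ h) `<=` rho by exact: relmul_preord.
have SE g : very_good_grading R rho_ g = smspan R rho (rho_ g) by [].
have liftS X g : X `<=` rho_ g ->
    very_good_grading R rho_ g (smlift rho (mxind R X)).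
  by move=> Xg; apply: smspan_lift (mxspan_sub Xg (mxspan_mxind R X)).
(* Shared by (v) and (vi): [mxind_mul] asks for both UV and VU to be diagonal, so the two orders are
   treated together. *)
have liftM (U V : binrel n) g : U `<=` rho_ g -> V `<=` rho_ g^-1%g ->
    relmul U V `<=` diagonal -> relmul V U `<=` diagonal ->
    smlift rho (mxind R U) * smlift rho (mxind R V) =
      smlift rho (mxind R (relmul U V)) /\
    smlift rho (mxind R V) * smlift rho (mxind R U) =
      smlift rho (mxind R (relmul V U)).
  move=> Ug Vg UVd VUd.
  have Ur := subset_trans Ug (@sub _); have Vr := subset_trans Vg (@sub _).
  have K X (Xr : X `<=` rho) := smliftK Xr (mxspan_mxind R X).
  split; apply: val_inj; rewrite /= !K//; try exact: relmul_preord;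
    exact: mxind_mul.
split; [|split; [|split; [|split; [|split]]]].
- split=> triv g /triv; rewrite SE -smspan0; first by move=> ->.
  by apply: smspan_inj.
(* Both sides become spans of relations: one direction is congruence, the other injectivity of
   [smspan]. *)
- split=> sym g; move: (sym g); rewrite !SE !addmul_smspan//; first by move=> ->.
  by apply: smspan_inj => //; exact: relmul_preord.
- split=> [[E /(epsilon_family_mxind R) HE]|]; last exact: ring_epsilon_strong_rel.
  by exists (fun g => smlift rho (mxind R (E g))).
- split=> str g; move: (str g); rewrite !SE !addmul_smspan//; first by move=> ->.
  exact: smspan_inj.
- move=> [E HE cr]; exists (fun g => smlift rho (mxind R (E g))).
    exact: epsilon_family_mxind.
  move=> g; have [U [V [Ug Vg UV VU]]] := cr g.
  (* This makes UV = [E g] and VU = [E g^-1] diagonal, as [liftM] requires. *)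
  have Ed h : E h `<=` diagonal by move=> p /HE.1[].
  exists (smlift rho (mxind R U)), (smlift rho (mxind R V)).
  have [||-> ->] := liftM U V g Ug Vg; rewrite ?UV ?VU//.
  by split=> //; exact: liftS.
move=> cr g; have [U [V [Ug Vg UV VU]]] := cr g.
exists (smlift rho (mxind R U)).
  exact: liftS.
exists (smlift rho (mxind R V)).
(* Reflexivity of rho puts the diagonal inside rho, so the lift is the identity matrix and not the
   default 0. *)
have lift1 : smlift rho (mxind R diagonal) = 1.
  have dr : @diagonal 'I_n `<=` rho by move=> [i j] ij; rewrite (ij : i = j); exact: prel_refl.
  apply: val_inj; rewrite /= (smliftK dr (mxspan_mxind R diagonal)).
  exact: mxind_diagonal.
by have [||-> ->] := liftM U V g Ug Vg; rewrite ?UV ?VU ?lift1.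
Qed.
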